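(* Let $\ast$ be a commutative, associative product on a finite-dimensional complex vector space $\mathcal{H}$ with basis $\{T_0,\ldots,T_m\}$ and corresponding linear coordinates $t^0,\ldots,t^m$. Define $(m+1)\times(m+1)$ matrices $\Gamma_i$, $i=0,\ldots,m$, by $T_i\ast T_j=\sum_k(\Gamma_i)^k_j\,T_k$ (row index $k$, column index $j$). Then a basis of the flat sections of the associated flat Dubrovin connection on $T\mathcal{H}$ is given by the columns of the matrix-valued function $$\exp\Big[-\sqrt{-1}\sum_{\ell=0}^m t^\ell\,\Gamma_\ell\Big],$$ each column being regarded as a vector field on $\mathcal{H}$ through its components in the basis $\{T_0,\ldots,T_m\}$.
   Context: The product $\ast$ is $\mathbb{C}$-bilinear and constant (independent of the point of $\mathcal{H}$). Every tangent space of $\mathcal{H}$ is identified with $\mathcal{H}$, so vector fields on $\mathcal{H}$ are (holomorphic) maps $X:\mathcal{H}\to\mathcal{H}$. The Dubrovin connection associated with $\ast$ is the connection on $T\mathcal{H}$ given by $\nabla_YX=dX(Y)+\sqrt{-1}\,Y\ast X$. A flat section is a vector field $X$ on $\mathcal{H}$ with $\nabla_YX=0$ for all $Y$; ''basis'' means basis of the complex vector space of all flat sections. *)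

(* Defs.v *)
From HB Require Import structures.
From mathcomp Require Import all_boot all_order all_algebra sesquilinear.
From mathcomp Require Import complex.
From mathcomp Require Import all_classical all_reals all_analysis.

Set Implicit Arguments.
Unset Strict Implicit.
Unset Printing Implicit Defensive.

Import Order.TTheory GRing.Theory Num.Theory.
Import numFieldNormedType.Exports.

Local Open Scope classical_set_scope.
Local Open Scope ring_scope.

(* A [vectType] carries no topology in the library.  [normed_vect H] is [H] with
   the sup norm of the coordinates in some fixed basis.  When [K] is the field of
   complex numbers all norms on [H] are equivalent, so [differentiable] and ['d]
   do not depend on this choice. *)
Definition normed_vect (K : numFieldType) (H : vectType K) : Type := H.

Section NormedVect.
Variables (K : numFieldType) (H : vectType K).

HB.instance Definition _ := Vector.copy (normed_vect H) H.

Definition vect_coord (x : normed_vect H) : 'rV[K]_(\dim {:H}) :=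
  \row_i coord (vbasis {:H}) i x.

Lemma vect_coord_linear : linear vect_coord.
Proof. by move=> a x y; apply/rowP=> i; rewrite !mxE linearP. Qed.

HB.instance Definition _ :=
  GRing.isLinear.Build K (normed_vect H) 'rV[K]_(\dim {:H}) _ vect_coord
    vect_coord_linear.

Definition vect_norm (x : normed_vect H) : K := `|vect_coord x|.

Lemma vect_norm_ler_normD (x y : normed_vect H) :
  vect_norm (x + y) <= vect_norm x + vect_norm y.
Proof. by rewrite /vect_norm linearD; exact: ler_normD. Qed.

Lemma vect_normZ (l : K) (x : normed_vect H) :
  vect_norm (l *: x) = `|l| * vect_norm x.
Proof. by rewrite /vect_norm linearZ; exact: normrZ. Qed.

Lemma vect_norm_eq0 (x : normed_vect H) : vect_norm x = 0 -> x = 0.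
Proof.
move=> /normr0_eq0 /rowP x0; rewrite (coord_vbasis (memvf (x : H))).
by apply: big1 => i _; have := x0 i; rewrite !mxE => ->; rewrite scale0r.
Qed.

HB.instance Definition _ := Lmodule_isNormed.Build K (normed_vect H)
  vect_norm_ler_normD vect_normZ vect_norm_eq0.

End NormedVect.

Section Dubrovin.
Variables (R : realType) (H : vectType R[i]).

Definition holomorphic (X : H -> H) : Prop :=
  forall p : normed_vect H, differentiable (X : normed_vect H -> normed_vect H) p.

(* [dubrovin star Y X] is nabla_Y X *)
Definition dubrovin (star : H -> H -> H) (Y X : H -> H) : H -> H := fun p =>
  'd (X : normed_vect H -> normed_vect H) (p : normed_vect H) (Y p)
  + 'i *: star (Y p) (X p).

Definition flat_section (star : H -> H -> H) : set (H -> H) :=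
  [set X | holomorphic X /\
    forall Y : H -> H, holomorphic Y -> forall p, dubrovin star Y X p = 0].

End Dubrovin.

(* [S] need not be a finite-dimensional subspace a priori; that it is a subspace
   is part of the second clause. *)
Definition is_basis (K : fieldType) (V : lmodType K) (n : nat)
    (S : set V) (e : 'I_n -> V) : Prop :=
  (forall c : 'I_n -> K, \sum_j c j *: e j = 0 -> forall j, c j = 0) /\
  S = range (fun c : 'I_n -> K => \sum_j c j *: e j).

Definition expmx (R : realType) (n : nat) (A : 'M[R[i]]_n.+1) : 'M[R[i]]_n.+1 :=
  limn (series (fun k => (k`!%:R)^-1 *: A ^+ k)).

Definition column_field (R : realType) (H : vectType R[i]) (n : nat)
    (T : n.-tuple H) (M : H -> 'M[R[i]]_n) (j : 'I_n) : H -> H :=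
  fun p => \sum_k M p k j *: T`_k.

(* Main.v *)
Require Import Defs.
From HB Require Import structures.
From mathcomp Require Import all_boot all_order all_algebra sesquilinear.
From mathcomp Require Import complex.
From mathcomp Require Import all_classical all_reals all_analysis.
From mathcomp Require Import lra ring.

Set Implicit Arguments.
Unset Strict Implicit.
Unset Printing Implicit Defensive.

Import Order.TTheory GRing.Theory Num.Theory.
Import numFieldNormedType.Exports.
Import Normc.

Local Open Scope complex_scope.
Local Open Scope classical_set_scope.
Local Open Scope ring_scope.

(** Let [A p] be the matrix of [x |-> p * x] in the basis [T]; it is linear in
    [p], and by associativity and commutativity the matrices [A p] commute.
    Hence
    [exp (- i A (p + v)) = exp (- i A p) - i exp (- i A p) A v + O(|v|^2)],
    so every field with coordinates [exp (- i A p) c] is holomorphic and flat;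
    at [p = 0] its coordinates are [c], which gives linear independence.
    Conversely, for a flat [X] the curve [s |-> exp (- i (1 - s) A p) X (s p)]
    has zero derivative, and comparing [s = 0] with [s = 1] gives
    [X p = exp (- i A p) X 0]. *)

(** * The complex modulus as a real number *)

Section ComplexModulus.
Variable R : realType.
Implicit Types x y : R[i].

Lemma normr_normc x : `|x| = (normc x)%:C.
Proof. by case: x. Qed.

Lemma normc_ge0 x : 0 <= normc x.
Proof. by case: x => a b; exact: sqrtr_ge0. Qed.

Lemma normcD x y : normc (x + y) <= normc x + normc y.
Proof. exact: le_normcD. Qed.

Lemma normcN x : normc (- x) = normc x.
Proof. exact: (normcN x). Qed.

Lemma Re_le_normc x : `|complex.Re x| <= normc x.
Proof. by rewrite -lecR -normr_normc normc_ge_Re. Qed.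

Lemma Im_le_normc x : `|complex.Im x| <= normc x.
Proof. by case: x => a b /=; rewrite -sqrtr_sqr ler_wsqrtr // lerDr sqr_ge0. Qed.

Lemma normc_le_ReIm x : normc x <= `|complex.Re x| + `|complex.Im x|.
Proof.
case: x => a b /=; rewrite -[leRHS]ger0_norm ?addr_ge0 // -sqrtr_sqr.
rewrite ler_wsqrtr // sqrrD !real_normK ?num_real// -addrA lerD2l.
by rewrite lerDr mulrn_wge0 ?mulr_ge0.
Qed.

Lemma gt0_complex_real x : 0 < x -> x = (complex.Re x)%:C /\ 0 < complex.Re x.
Proof. by case: x => a b; rewrite ltcE/= => /andP[/eqP -> ->]. Qed.

Lemma normc_natV n : normc (n%:R^-1 : R[i]) = n%:R^-1.
Proof.
apply: complexI; rewrite -normr_normc ger0_norm ?invr_ge0 ?ler0n//.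
by rewrite fmorphV rmorph_nat.
Qed.

Lemma normc_natr n : normc (n%:R : R[i]) = n%:R.
Proof. by apply: complexI; rewrite -normr_normc ger0_norm ?ler0n// rmorph_nat. Qed.

End ComplexModulus.

(** * The entrywise sum norm of complex matrices *)

Section EntrySumNorm.
Variable R : realType.

(* Submultiplicative, and real-valued: the norm of ['M[R[i]]_(m, n)] takes its
   values in the merely partially ordered field [R[i]]. *)
Definition l1norm m n (M : 'M[R[i]]_(m, n)) : R := \sum_i \sum_j normc (M i j).

Lemma l1norm_ge0 m n (M : 'M[R[i]]_(m, n)) : 0 <= l1norm M.
Proof. by do 2!apply: sumr_ge0 => ? _; exact: normc_ge0. Qed.

Lemma l1norm_entry m n (M : 'M[R[i]]_(m, n)) i j : normc (M i j) <= l1norm M.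
Proof.
rewrite /l1norm (bigD1 i)//= (bigD1 j)//= -addrA lerDl addr_ge0//.
  by apply: sumr_ge0 => ? _; exact: normc_ge0.
by do 2!apply: sumr_ge0 => ? _; exact: normc_ge0.
Qed.

(** The hypothesis is an inequality because matrix identities are obtained below as limits of upper
    bounds. *)
Lemma l1norm_eq0 m n (M : 'M[R[i]]_(m, n)) : l1norm M <= 0 -> M = 0.
Proof.
move=> M0; apply/matrixP => i j; rewrite mxE; apply: eq0_normc; apply/eqP.
by rewrite eq_le normc_ge0 (le_trans (l1norm_entry M i j)).
Qed.

Lemma l1norm0 m n : l1norm (0 : 'M[R[i]]_(m, n)) = 0.
Proof. by rewrite /l1norm !big1// => i _; rewrite big1// => j _; rewrite mxE normc0. Qed.

Lemma l1normD m n (M N : 'M[R[i]]_(m, n)) : l1norm (M + N) <= l1norm M + l1norm N.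
Proof.
rewrite /l1norm -big_split/= ler_sum// => i _; rewrite -big_split/= ler_sum// => j _.
by rewrite mxE normcD.
Qed.

Lemma l1normN m n (M : 'M[R[i]]_(m, n)) : l1norm (- M) = l1norm M.
Proof. by rewrite /l1norm; under eq_bigr do under eq_bigr do rewrite mxE normcN. Qed.

Lemma l1normZ m n a (M : 'M[R[i]]_(m, n)) : l1norm (a *: M) = normc a * l1norm M.
Proof.
rewrite /l1norm mulr_sumr; apply: eq_bigr => i _; rewrite mulr_sumr.
by apply: eq_bigr => j _; rewrite mxE normcM.
Qed.

Lemma normc_sum I (r : seq I) (P : pred I) (F : I -> R[i]) :
  normc (\sum_(i <- r | P i) F i) <= \sum_(i <- r | P i) normc (F i).
Proof.
elim/big_ind2: _ => //; first by rewrite normc0.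
by move=> x a y b xa yb; exact: (le_trans (normcD _ _) (lerD xa yb)).
Qed.

Lemma l1norm_sum I (r : seq I) (P : pred I) m n (F : I -> 'M[R[i]]_(m, n)) :
  l1norm (\sum_(i <- r | P i) F i) <= \sum_(i <- r | P i) l1norm (F i).
Proof.
elim/big_ind2: _ => //; first by rewrite l1norm0.
by move=> x a y b xa yb; exact: (le_trans (l1normD _ _) (lerD xa yb)).
Qed.

Lemma l1normM m n p (M : 'M[R[i]]_(m, n)) (N : 'M[R[i]]_(n, p)) :
  l1norm (M *m N) <= l1norm M * l1norm N.
Proof.
have -> : l1norm M * l1norm N = \sum_i \sum_k normc (M i k) * l1norm N.
  by rewrite /l1norm mulr_suml; apply: eq_bigr => i _; rewrite mulr_suml.
apply: ler_sum => i _.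
apply: (@le_trans _ _ (\sum_j \sum_k normc (M i k) * normc (N k j))).
  apply: ler_sum => j _; rewrite mxE (le_trans (normc_sum _ _ _))//.
  by apply: ler_sum => k _; rewrite normcM.
rewrite exchange_big/=; apply: ler_sum => k _; rewrite -mulr_sumr.
rewrite ler_wpM2l ?normc_ge0// /l1norm (bigD1 k)//= lerDl.
by do 2!apply: sumr_ge0 => ? _; exact: normc_ge0.
Qed.

End EntrySumNorm.

(** * Convergence of the matrix exponential series *)

Section ExpmxConvergence.
Variables (R : realType) (d : nat).
Local Notation C := (R[i] : numFieldType).
Local Notation M := 'M[R[i]]_d.+1.
Implicit Types A B : M.

Lemma mx_norm_le_l1norm m n (A : 'M[R[i]]_(m, n)) : `|A| <= (l1norm A)%:C.
Proof.
have [/eqP A0|/mx_norm_neq0[[i j] /= ij]] := boolP (mx_norm A == 0).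
  by rewrite /Num.norm/= A0 lecR l1norm_ge0.
by rewrite /Num.norm/= ij normr_normc lecR l1norm_entry.
Qed.

(** Links the real norm to the topology in which [expmx] takes its limit. A positive element of
    [R[i]] is real, so real radii suffice. *)
Lemma l1norm_cvg m n (f : nat -> 'M[C]_(m, n)) (L : 'M[C]_(m, n)) :
  l1norm (f k - L) @[k --> \oo] --> (0 : R) -> f @ \oo --> L.
Proof.
move=> fL; apply/cvgrPdist_lt => e /gt0_complex_real[-> e0].
move/cvgrPdist_lt : fL => /(_ _ e0); apply: filterS => k.
rewrite sub0r normrN ger0_norm ?l1norm_ge0// => h.
by rewrite distrC (le_lt_trans (mx_norm_le_l1norm _))// ltcR.
Qed.

(** The norm of the identity is the matrix size, not 1; the factor [l1norm 1] pays for this at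
    [k = 0]. *)
Lemma l1normX A k : l1norm (A ^+ k) <= l1norm (1 : M) * l1norm A ^+ k.
Proof.
elim: k => [|k IH]; first by rewrite !expr0 mulr1.
rewrite exprSr exprSr mulrA (le_trans (l1normM _ _))//.
by rewrite ler_wpM2r// l1norm_ge0.
Qed.

Definition expterm A k : M := (k`!%:R)^-1 *: A ^+ k.

Lemma l1norm_expterm A k :
  l1norm (expterm A k) <= l1norm (1 : M) * exp_coeff (l1norm A) k.
Proof.
rewrite l1normZ normc_natV /exp_coeff/= mulrA [leLHS]mulrC.
rewrite ler_wpM2r ?invr_ge0 ?ler0n//.
exact: l1normX.
Qed.

(** [phi] stands for the real or the imaginary part. Up to a constant factor, the terms are
    dominated by those of the real exponential series at [l1norm A]. *)
Lemma is_cvg_series_expterm A (phi : R[i] -> R) i j :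
  (forall x, `|phi x| <= normc x) ->
  cvgn (series (fun k => phi (expterm A k i j))).
Proof.
move=> phile; apply: normed_cvg.
apply: (@series_le_cvg _ _ (fun k => l1norm (1 : M) * exp_coeff (l1norm A) k)) => [n|n|n|].
- exact: normr_ge0.
- by rewrite mulr_ge0 ?l1norm_ge0// exp_coeff_ge0// l1norm_ge0.
- exact: le_trans (phile _) (le_trans (l1norm_entry _ _ _) (l1norm_expterm _ _)).
- exact: is_cvg_seriesZ (is_cvg_series_exp_coeff _).
Qed.

Lemma series_entry (phi : R[i] -> R) (phi0 : phi 0 = 0)
    (phiD : {morph phi : x y / x + y}) A i j n :
  phi (series (expterm A) n i j) = series (fun k => phi (expterm A k i j)) n.
Proof.
rewrite /series/= summxE; elim/big_ind2: _ => // x a y b <- <-.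
exact: phiD.
Qed.

Lemma cvg_dist0 (u : nat -> R) :
  cvgn u -> `|u n - limn u| @[n --> \oo] --> (0 : R).
Proof.
move=> cu; apply/norm_cvg0P; rewrite -(subrr (limn u)).
by apply: cvgB => //; exact: cvg_cst.
Qed.

Lemma cvg_sum0 (I : finType) (F : I -> nat -> R) :
  (forall i, F i n @[n --> \oo] --> (0 : R)) ->
  \sum_i F i n @[n --> \oo] --> (0 : R).
Proof.
move=> F0; elim: (index_enum I) => [|i s IH].
  by under eq_fun do rewrite big_nil; exact: cvg_cst.
under eq_fun do rewrite big_cons.
by have := cvgD (F0 i) IH; rewrite addr0; apply.
Qed.

(** A [limn] carries information only once convergence is known; the later facts on [expmx] all rest
    on this one. *)
Lemma expmx_cvg A : l1norm (series (expterm A) n - expmx A) @[n --> \oo] --> (0 : R).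
Proof.
pose re i j : nat -> R := series (fun k => complex.Re (expterm A k i j)).
pose im i j : nat -> R := series (fun k => complex.Im (expterm A k i j)).
(* The candidate limit is built entry by entry from the real and imaginary series; uniqueness of
   limits then identifies it with [expmx A]. *)
pose L : M := \matrix_(i, j) (limn (re i j) +i* limn (im i j)).
have SL : l1norm (series (expterm A) n - L) @[n --> \oo] --> (0 : R).
  pose h n := \sum_(i < d.+1) \sum_(j < d.+1)
      (`|re i j n - limn (re i j)| + `|im i j n - limn (im i j)|).
  apply: (@squeeze_cvgr _ _ _ _ (cst 0) h); last 2 first.
  - exact: cvg_cst.
  - apply: cvg_sum0 => i; apply: cvg_sum0 => j.
    have re_cvg : cvgn (re i j) by apply: is_cvg_series_expterm; exact: Re_le_normc.
    have im_cvg : cvgn (im i j) by apply: is_cvg_series_expterm; exact: Im_le_normc.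
    by have := cvgD (cvg_dist0 re_cvg) (cvg_dist0 im_cvg); rewrite addr0; apply.
  apply: nearW => n; rewrite l1norm_ge0/= /l1norm.
  apply: ler_sum => i _; apply: ler_sum => j _.
  rewrite (le_trans (normc_le_ReIm _))// !mxE.
  rewrite /re /im -!series_entry//; [by case: (series (expterm A) n i j) |..];
    by move=> [? ?] [? ?].
suff AL : expmx A = L by rewrite AL.
exact: (cvg_lim (@norm_hausdorff C 'M[C]_d.+1) (l1norm_cvg SL)).
Qed.

End ExpmxConvergence.

(** * Commuting matrices and the first-order expansion of the exponential *)

Lemma commrZ (K : comNzRingType) (L : algType K) (a : K) (x y : L) :
  GRing.comm x y -> GRing.comm x (a *: y).
Proof. by move=> xy; rewrite /GRing.comm -scalerAl -scalerAr xy. Qed.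

Section ExpmxRemainder.
Variables (R : realType) (d : nat).
Local Notation M := 'M[R[i]]_d.+1.
Implicit Types A B : M.

(** Carries bounds from partial sums to limits: [e n] will be built from distances of partial sums
    to [expmx]. *)
Lemma le_of_cvg0 (x c : R) (e : nat -> R) :
  (forall n, x <= c + e n) -> e n @[n --> \oo] --> (0 : R) -> x <= c.
Proof.
move=> xc e0; have := cvgD (cvg_cst c) e0; rewrite addr0 => h.
by apply: (cvgr_to_ge (h _ _)); apply: nearW => n; exact: xc.
Qed.

(* For commuting [A] and [B], what remains of [(A + B) ^+ k] after its terms of
   degree at most 1 in [B]. *)
Definition powrem A B k : M := (A + B) ^+ k - A ^+ k - (A ^+ k.-1 * B) *+ k.

(** Multiplying the linear term [k A^(k-1) B] by [A + B] yields [k A^k B], still linear in [B], and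
    [k B A^(k-1) B], which joins the remainder. *)
Lemma powremS A B k : GRing.comm A B ->
  powrem A B k.+1 = (A + B) * powrem A B k + (B * A ^+ k.-1 * B) *+ k.
Proof.
move=> cAB; have cB : B * A ^+ k = A ^+ k * B by apply/commrX/commr_sym.
(* At [k = 0] the truncated [k.-1] is harmless, both sides being zero multiples. *)
have AN : (A * (A ^+ k.-1 * B)) *+ k = (A ^+ k * B) *+ k.
  by case: k {cB} => [|k]; rewrite ?mulr0n// mulrA -exprS.
rewrite /powrem [k.+1.-1]/= ![_ ^+ k.+1]exprS !mulrBr mulrnAr.
rewrite [(A + B) * (A ^+ k.-1 * B)]mulrDl mulrnDl AN [(A + B) * A ^+ k]mulrDl cB.
rewrite [B * (_ * B)]mulrA mulrS.
move: (B * _ * B *+ k) (A ^+ k * B *+ k) (A ^+ k * B) => U V W.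
move: ((A + B) * (A + B) ^+ k) (A * A ^+ k) => X Y.
by apply/matrixP => i j; rewrite !mxE; ring.
Qed.

(** Induction along [powremS], using [k^2 + k <= (k + 1)^2]. The assumption [1 <= r] allows
    [r^(k-1)] to be replaced by [r^(k+1)]. *)
Lemma l1norm_powrem A B k (r : R) : GRing.comm A B -> 1 <= r -> l1norm A <= r ->
    l1norm (A + B) <= r ->
  l1norm (powrem A B k) <= l1norm (1 : M) * l1norm B ^+ 2 * (k%:R ^+ 2 * r ^+ k).
Proof.
move=> cAB r1 Ar ABr; have r0 : 0 <= r by exact: le_trans r1.
have n1 := l1norm_ge0 (1 : M); have nB := l1norm_ge0 B.
elim: k => [|k IH].
  by rewrite /powrem !expr0 mulr0n subrr subr0 l1norm0 !mulr_ge0 ?exprn_ge0.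
rewrite powremS// (le_trans (l1normD _ _))//.
set c := l1norm 1 * _ in IH *.
have c0 : 0 <= c by rewrite mulr_ge0// exprn_ge0.
have h1 : l1norm ((A + B) * powrem A B k) <= c * (k%:R ^+ 2 * r ^+ k.+1).
  rewrite (le_trans (l1normM _ _))// (le_trans (ler_pM _ _ ABr IH))// ?l1norm_ge0//.
  by rewrite [r ^+ k.+1]exprS le_eqVlt; apply/orP; left; apply/eqP; ring.
have h2 : l1norm ((B * A ^+ k.-1 * B) *+ k) <= c * (k%:R * r ^+ k.+1).
  rewrite -scaler_nat l1normZ normc_natr mulrCA ler_wpM2l ?ler0n//.
  rewrite (le_trans (l1normM _ _))//.
  apply: (@le_trans _ _ (l1norm B * (l1norm (1 : M) * r ^+ k.-1) * l1norm B)).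
    rewrite ler_wpM2r// (le_trans (l1normM _ _))// ler_wpM2l// (le_trans (l1normX _ _))//.
    by rewrite ler_wpM2l// lerXn2r// ?nnegrE// l1norm_ge0.
  rewrite /c expr2 [leLHS](_ : _ =
    l1norm (1 : M) * (l1norm B * l1norm B) * r ^+ k.-1); last by ring.
  by rewrite ler_wpM2l// ler_weXn2l// (leq_trans (leq_pred _)).
rewrite (le_trans (lerD h1 h2))// -mulrDr ler_wpM2l// -mulrDl ler_wpM2r ?exprn_ge0//.
by rewrite -natr1; have := ler0n R k; nra.
Qed.

(** Absorbs the factor [k^2] into the base, so that the sum of [k^2 r^k / k!] is bounded by
    [expR (4 * r)]. *)
Lemma natr_sqr_le (k : nat) : (k%:R ^+ 2 : R) <= 4 ^+ k.
Proof.
rewrite (_ : 4 = 2 ^+ 2 :> R); last by ring.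
rewrite -exprM mulnC exprM lerXn2r ?nnegrE ?exprn_ge0// -natrX.
by rewrite ler_nat ltnW// ltn_expl.
Qed.

(** Since [k / k! = 1 / (k-1)!], the linear parts form the series of [A] shifted by one degree;
    hence [n] terms there against [n.+1] elsewhere. *)
Lemma series_exptermB A B n :
  series (expterm (A + B)) n.+1 - series (expterm A) n.+1
    - series (expterm A) n * B
  = \sum_(0 <= k < n.+1) (k`!%:R)^-1 *: powrem A B k.
Proof.
have -> : series (expterm A) n * B =
    \sum_(0 <= k < n.+1) (k`!%:R)^-1 *: ((A ^+ k.-1 * B) *+ k).
  rewrite [RHS]big_nat_recl//= mulr0n scaler0 add0r /series/= mulr_suml.
  apply: eq_bigr => k _.
  rewrite /expterm -scalerAl -[(_ * B) *+ _]scaler_nat scalerA; congr (_ *: _).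
  rewrite factS natrM invfM mulrAC mulVf ?mul1r// pnatr_eq0//.
rewrite /series/= -!sumrB; apply: eq_bigr => k _.
by rewrite /expterm !scalerBr.
Qed.

(** The bound does not depend on [n], so it survives the passage to the limit. *)
Lemma l1norm_series_exptermB A B (r : R) n :
    GRing.comm A B -> 1 <= r -> l1norm A <= r -> l1norm (A + B) <= r ->
  l1norm (series (expterm (A + B)) n.+1 - series (expterm A) n.+1
          - series (expterm A) n * B)
  <= l1norm (1 : M) * l1norm B ^+ 2 * expR (4 * r).
Proof.
move=> cAB r1 Ar ABr; have r0 : 0 <= r by exact: le_trans r1.
have c0 : 0 <= l1norm (1 : M) * l1norm B ^+ 2 by rewrite mulr_ge0 ?exprn_ge0// l1norm_ge0.
rewrite series_exptermB (le_trans (l1norm_sum _ _ _))//.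
apply: (@le_trans _ _ (l1norm (1 : M) * l1norm B ^+ 2 * series (exp_coeff (4 * r)) n.+1)).
  rewrite /series/= mulr_sumr; apply: ler_sum => k _.
  rewrite l1normZ normc_natV /exp_coeff/= mulrA [leLHS]mulrC ler_wpM2r ?invr_ge0 ?ler0n//.
  rewrite (le_trans (l1norm_powrem _ cAB r1 Ar ABr))// ler_wpM2l// exprMn.
  by rewrite ler_wpM2r ?exprn_ge0// natr_sqr_le.
rewrite ler_wpM2l// /expR; apply: nondecreasing_cvgn_le; last exact: is_cvg_series_exp_coeff.
by apply: nondecreasing_series => k _ _; rewrite exp_coeff_ge0// mulr_ge0.
Qed.

Lemma cvg_shift1 (u : nat -> R) :
  u n @[n --> \oo] --> (0 : R) -> u n.+1 @[n --> \oo] --> (0 : R).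
Proof. by move=> u0; rewrite (cvg_shiftS u). Qed.

Lemma l1norm_expmxB A B (r : R) : GRing.comm A B -> 1 <= r -> l1norm A <= r ->
    l1norm (A + B) <= r ->
  l1norm (expmx (A + B) - expmx A - expmx A * B)
  <= l1norm (1 : M) * l1norm B ^+ 2 * expR (4 * r).
Proof.
move=> cAB r1 Ar ABr.
pose e (X : M) n := l1norm (series (expterm X) n - expmx X).
have e0 X : e X n @[n --> \oo] --> (0 : R) by exact: expmx_cvg.
(* The three errors come from replacing each partial sum by its limit. *)
apply: (@le_of_cvg0 _ _ (fun n => e (A + B) n.+1 + e A n.+1 + e A n * l1norm B)).
  move=> n; apply: le_trans (lerD (l1norm_series_exptermB n cAB r1 Ar ABr) (lexx _)).
  rewrite [X in l1norm X <= _](_ : _ =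
    (series (expterm (A + B)) n.+1 - series (expterm A) n.+1
      - series (expterm A) n * B)
    + (- (series (expterm (A + B)) n.+1 - expmx (A + B))
       + (series (expterm A) n.+1 - expmx A)
       + (series (expterm A) n - expmx A) * B)); last first.
    rewrite mulrBl; move: (series (expterm A) n * B) (expmx A * B) => U V.
    move: (series (expterm (A + B)) n.+1) (series (expterm A) n.+1) => W X.
    move: (expmx (A + B)) (expmx A) => Y Z.
    by apply/matrixP => i j; rewrite !mxE; ring.
  rewrite (le_trans (l1normD _ _))// lerD2l (le_trans (l1normD _ _))//.
  rewrite lerD//; last exact: l1normM.
  by rewrite (le_trans (l1normD _ _))// l1normN.
have := cvgD (cvgD (cvg_shift1 (e0 (A + B))) (cvg_shift1 (e0 A)))
  (cvgM (e0 A) (cvg_cst (l1norm B))).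
rewrite mul0r !addr0; exact.
Qed.

(** The form used for differentiation: [t] is the size of the increment and [b] bounds the linear
    map producing [B]. Since [t <= 1], the radius [r] can be chosen independently of [B]. *)
Lemma l1norm_expmxB_quadratic A B (b t : R) : GRing.comm A B ->
    0 <= b -> 0 <= t -> t <= 1 -> l1norm B <= b * t ->
  l1norm (expmx (A + B) - expmx A - expmx A * B)
  <= l1norm (1 : M) * b ^+ 2 * expR (4 * (1 + l1norm A + b)) * t ^+ 2.
Proof.
move=> cAB b0 t0 t1 Bbt; set r := 1 + l1norm A + b.
have A0 := l1norm_ge0 A.
have Bb : l1norm B <= b by rewrite (le_trans Bbt)// ler_piMr.
have r1 : 1 <= r by rewrite /r -addrA lerDl addr_ge0.
have Ar : l1norm A <= r by rewrite /r -addrA addrCA lerDl addr_ge0.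
have ABr : l1norm (A + B) <= r by rewrite (le_trans (l1normD _ _))// /r lerD// lerDr.
apply: le_trans (l1norm_expmxB cAB r1 Ar ABr) _.
rewrite [leRHS]mulrAC ler_wpM2r ?expR_ge0// -mulrA ler_wpM2l ?l1norm_ge0// -exprMn.
by rewrite lerXn2r// ?nnegrE ?mulr_ge0 ?l1norm_ge0.
Qed.

(** Partial sums are polynomials in [A], hence commute with [B]; the commutator of the limit is then
    bounded by a vanishing approximation error. *)
Lemma expmx_comm A B : GRing.comm A B -> GRing.comm (expmx A) B.
Proof.
move=> cAB; apply/subr0_eq/l1norm_eq0.
pose e n := l1norm (series (expterm A) n - expmx A).
apply: (@le_of_cvg0 _ _ (fun n => e n * l1norm B + l1norm B * e n)); last first.
  have e0 : e n @[n --> \oo] --> (0 : R) by exact: expmx_cvg.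
  have := cvgD (cvgM e0 (cvg_cst (l1norm B))) (cvgM (cvg_cst (l1norm B)) e0).
  rewrite mulr0 mul0r addr0; exact.
move=> n; rewrite add0r.
have cS : series (expterm A) n * B = B * series (expterm A) n.
  apply/esym/commr_sum => k _; apply/commr_sym; rewrite /GRing.comm -scalerAl -scalerAr.
  by congr (_ *: _); apply/esym/commrX/commr_sym.
rewrite [X in l1norm X <= _](_ : _ = - ((series (expterm A) n - expmx A) * B)
   + B * (series (expterm A) n - expmx A)); last first.
  by rewrite mulrBl mulrBr cS opprB addrA subrK.
by rewrite (le_trans (l1normD _ _))// lerD// ?l1normN l1normM.
Qed.

Lemma expmx0 : expmx (0 : M) = 1.
Proof.
apply/esym/subr0_eq/l1norm_eq0.
(* The index starts at [n.+1] because the empty partial sum is 0, whereas all others equal 1. *)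
apply: (@le_of_cvg0 _ _ (fun n => l1norm (series (expterm 0) n.+1 - expmx (0 : M)))).
  move=> n; rewrite add0r le_eqVlt; apply/orP; left; apply/eqP; congr (l1norm (_ - _)).
  rewrite /series/= big_nat_recl//= /expterm expr0 fact0 invr1 scale1r big1 ?addr0//.
  by move=> k _; rewrite expr0n scaler0.
exact: cvg_shift1 (expmx_cvg _).
Qed.

End ExpmxRemainder.

(** * Differentiability from a quadratic remainder bound *)

Section QuadraticRemainder.
Variables (K : numFieldType) (V W : normedModType K).

Lemma linear_of_le_continuous (f : {linear V -> W}) (c : K) :
  0 < c -> (forall v, `|f v| <= c * `|v|) -> continuous f.
Proof.
move=> c0 fc p; apply/cvgrPdist_lt => e e0.
near=> q; rewrite -linearB (le_lt_trans (fc _))// mulrC -ltr_pdivlMr//.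
near: q; apply: cvgr_dist_lt => //; exact: divr_gt0.
Unshelve. all: by end_near. Qed.

(** The remainder is [o(v)], since [c |v|^2 <= e |v|] as soon as [|v| <= e / c]. The linear bound
    supplies the continuity that a differential requires. *)
Lemma is_diff_quadratic (f df : V -> W) (p : V) (c : K) :
    linear df -> 0 < c -> (forall v, `|df v| <= c * `|v|) ->
    (forall v, `|v| <= 1 -> `|f (v + p) - f p - df v| <= c * `|v| ^+ 2) ->
  is_diff p f df.
Proof.
move=> dfl c0 dfc fc.
pose L : {linear V -> W} := HB.pack_for {linear V -> W} df
  (GRing.isLinear.Build _ _ _ _ df dfl).
have Lc : continuous L by apply: (@linear_of_le_continuous L c c0 dfc).
have fL : f \o shift p = cst (f p) + L +o_ 0 id.
  apply/eqaddoP => e e0; near=> v.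
  rewrite [X in `|X|](_ : _ = f (v + p) - f p - df v); last first.
    by rewrite !fctE /= opprD addrA.
  have v1 : `|v| <= 1 by near: v; apply: nbhs0_le.
  rewrite (le_trans (fc _ v1))//.
  rewrite expr2 mulrA ler_wpM2r// mulrC -ler_pdivlMr//.
  by near: v; apply: nbhs0_le; exact: divr_gt0.
have dL := diff_unique Lc fL.
by split => //; apply/diff_locallyP; rewrite dL.
Unshelve. all: by end_near. Qed.

Lemma is_diff_linear (f : V -> W) (p : V) (c : K) :
  linear f -> 0 < c -> (forall v, `|f v| <= c * `|v|) -> is_diff p f f.
Proof.
move=> fl c0 fc; apply: (is_diff_quadratic fl c0 fc) => v _.
rewrite -[v + p]scale1r (_ : f (1 *: (v + p)) = f v + f p).
  by rewrite addrK subrr normr0 mulr_ge0 ?exprn_ge0// ltW.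
by rewrite scale1r -[v in LHS]scale1r fl scale1r.
Qed.

End QuadraticRemainder.

(** * Functions of a complex variable with zero derivative *)

Section ComplexLine.
Variable R : realType.
Local Notation C := (R[i] : numFieldType).

(** The hypotheses on [phi] are those shared by the real and imaginary parts. The real difference
    quotient is [phi] of the complex one at a real increment, and [phi] does not increase the
    modulus. *)
Lemma is_derive_real_part (phi : R[i] -> R) (f : C -> C) (t : R) :
    (forall x, `|phi x| <= normc x) -> {morph phi : x y / x - y} ->
    (forall (r : R) x, phi (r%:C * x) = r * phi x) ->
    is_derive (t%:C : C) (1 : C) f 0 ->
  is_derive t (1 : R) (fun u : R => phi (f u%:C)) (0 : R).
Proof.
move=> phile phiB phiZ [df d0].
have f0 : (fun h : C =>
    h^-1 *: ((f \o shift (t%:C : C)) (h *: (1 : C)) - f t%:C)) @ 0^' --> 'D_(1 : C) f (t%:C : C).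
  exact: df.
rewrite d0 in f0.
suff h0 : (fun h : R => h^-1 *:
    (((fun u : R => phi (f u%:C)) \o shift t) (h *: (1 : R)) - phi (f t%:C))) @ 0^' --> (0 : R).
  by split; [apply/cvg_ex; exists 0 | exact: cvg_lim h0].
apply/cvgrPdist_lt => e e0.
have eC0 : 0 < e%:C by rewrite ltcR.
move/cvgrPdist_lt : f0 => /(_ _ eC0).
move=> /nbhs_ballP[d d0' hd]; have [dE dR] := gt0_complex_real d0'.
near=> h.
have h0 : h != 0 by near: h; exact: nbhs_dnbhs_neq.
have /hd : ball (0 : C) d (h%:C : C).
  rewrite -ball_normE /= sub0r normrN normr_normc dE ltcR /= expr0n addr0 sqrtr_sqr.
  by near: h; apply: dnbhs0_lt.
have hC0 : (h%:C : C) != 0 by rewrite -(rmorph0 (real_complex R)) (inj_eq (@complexI R)).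
move=> /(_ hC0); rewrite !sub0r !normrN normr_normc ltcR; apply: le_lt_trans.
rewrite (le_trans _ (phile _))// /GRing.scale/= !mulr1 -phiB -rmorphD/=.
by rewrite -fmorphV phiZ.
Unshelve. all: by end_near. Qed.

(** The real and imaginary parts, restricted to the real axis, have zero derivative and are
    therefore constant. *)
Lemma is_derive_0_complex (f : C -> C) :
  (forall s : C, is_derive s (1 : C) f 0) -> f 1 = f 0.
Proof.
move=> df.
have aux phi : (forall x, `|phi x| <= normc x) -> {morph phi : x y / x - y} ->
    (forall (r : R) x, phi (r%:C * x) = r * phi x) -> phi (f 1) = phi (f 0).
  move=> h1 h2 h3.
  exact: (@is_derive_0_is_cst _ (fun u : R => phi (f u%:C)) 1 0
    (fun t => is_derive_real_part h1 h2 h3 (df _))).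
have re := aux _ (@Re_le_normc R); have im := aux _ (@Im_le_normc R).
apply/eqP; rewrite eq_complex re ?im ?eqxx//;
  first [by move=> [? ?] [? ?] | by move=> r [a b] /=; rewrite mul0r ?subr0 ?addr0].
Qed.

End ComplexLine.

(** * Bounds for linear maps from [H] to matrices *)

Lemma mx_norm_ge_entry (K : numDomainType) m n (A : 'M[K]_(m, n)) i j :
  `|A i j| <= `|A|.
Proof.
rewrite [leRHS]/Num.norm/= mx_normE -[leLHS]nngE num_le.
exact: (le_bigmax _ (fun ij : _ * _ => (`|A ij.1 ij.2|)%:nng) (i, j)).
Qed.

Section LinearBounds.
Variables (R : realType) (H : vectType R[i]).
Local Notation C := (R[i] : numFieldType).
Local Notation N := (@normed_vect C H).

(** Norms over [C] are elements of [R[i]]; their real parts can be compared with [l1norm]. *)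
Lemma normr_Re (V : normedModType C) (v : V) : `|v| = (complex.Re `|v|)%:C.
Proof. by rewrite RRe_real// normr_real. Qed.

Lemma Re_normr_ge0 (V : normedModType C) (v : V) : 0 <= complex.Re `|v|.
Proof. by rewrite -ler0c -normr_Re. Qed.

Lemma normc_vbasis_coord (v : N) i :
  normc (coord (vbasis {:H}) i v) <= complex.Re `|v|.
Proof.
rewrite -lecR -normr_Re -normr_normc.
by have := mx_norm_ge_entry (vect_coord v) 0 i; rewrite mxE.
Qed.

(** The images of the fixed basis give the constant, because the norm of [normed_vect] bounds the
    coordinates in that basis. *)
Lemma linear_l1norm_bounded m n (f : {linear H -> 'M[R[i]]_(m, n)}) :
  exists2 c : R, 0 <= c & forall v : N, l1norm (f v) <= c * complex.Re `|v|.
Proof.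
exists (\sum_(i < \dim {:H}) l1norm (f (vbasis {:H})`_i)) => [|v].
  by apply: sumr_ge0 => i _; exact: l1norm_ge0.
rewrite [v in f v](coord_vbasis (memvf (v : H))) linear_sum mulr_suml.
rewrite (le_trans (l1norm_sum _ _ _))//; apply: ler_sum => i _.
by rewrite linearZ/= l1normZ mulrC ler_wpM2l ?l1norm_ge0// normc_vbasis_coord.
Qed.

End LinearBounds.

(** * Coordinates in the basis [T] and multiplication matrices *)

Section Frame.
Variables (R : realType) (m : nat) (H : vectType R[i]) (T : m.+1.-tuple H).
Local Notation C := (R[i] : numFieldType).
Local Notation N := (@normed_vect C H).

Definition frame_vec (c : 'cV[R[i]]_m.+1) : H := \sum_k c k 0 *: T`_k.

Lemma frame_vec_linear : linear frame_vec.
Proof.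
move=> a x y; rewrite /frame_vec scaler_sumr -big_split; apply: eq_bigr => k _.
by rewrite !mxE scalerDl scalerA.
Qed.

HB.instance Definition _ :=
  GRing.isLinear.Build R[i] 'cV[R[i]]_m.+1 H _ frame_vec frame_vec_linear.

Definition frame_coord (x : H) : 'cV[R[i]]_m.+1 := \col_k coord T k x.

Lemma frame_coord_linear : linear frame_coord.
Proof. by move=> a x y; apply/colP => k; rewrite !mxE linearP. Qed.

HB.instance Definition _ :=
  GRing.isLinear.Build R[i] H 'cV[R[i]]_m.+1 _ frame_coord frame_coord_linear.

Lemma frame_vec_bounded : exists2 a : R, 0 <= a &
  forall c, `|frame_vec c : N| <= (a * l1norm c)%:C.
Proof.
exists (\sum_(k < m.+1) complex.Re `|T`_k : N|) => [|c].
  by apply: sumr_ge0 => k _; exact: Re_normr_ge0.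
rewrite mulr_suml rmorph_sum (le_trans (ler_norm_sum _ _ _))//; apply: ler_sum => k _.
rewrite normrZ normr_normc [X in _ * X]normr_Re -rmorphM lecR mulrC.
by rewrite ler_wpM2l ?Re_normr_ge0 ?l1norm_entry.
Qed.

Section Basis.
Hypothesis T_basis : basis_of fullv T.

Lemma frame_vecK : cancel frame_vec frame_coord.
Proof. by move=> c; apply/colP => k; rewrite mxE coord_sum_free// (basis_free T_basis). Qed.

Lemma frame_coordK : cancel frame_coord frame_vec.
Proof.
move=> x; rewrite [RHS](coord_basis T_basis (memvf x)).
by apply: eq_bigr => k _; rewrite mxE.
Qed.

Variables (star : {bilinear H -> H -> H}) (Gamma : 'I_m.+1 -> 'M[R[i]]_m.+1).
Hypothesis starC : commutative star.
Hypothesis starA : associative star.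
Hypothesis GammaE : forall i j : 'I_m.+1,
  star T`_i T`_j = \sum_(k < m.+1) Gamma i k j *: T`_k.

(** This is the [A p] of the overview; [star_frame_vec] justifies the reading. *)
Definition mul_mx (p : H) : 'M[R[i]]_m.+1 := \sum_(l < m.+1) coord T l p *: Gamma l.

Lemma mul_mx_linear : linear mul_mx.
Proof.
move=> a p q; rewrite /mul_mx scaler_sumr -big_split; apply: eq_bigr => l _.
by rewrite linearP scalerDl scalerA.
Qed.

HB.instance Definition _ :=
  GRing.isLinear.Build R[i] H 'M[R[i]]_m.+1 _ mul_mx mul_mx_linear.

(** Bilinearity reduces the claim to products of basis vectors, and [GammaE] makes such a product a
    column of [Gamma l]. *)
Lemma star_frame_vec p c : star p (frame_vec c) = frame_vec (mul_mx p *m c).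
Proof.
have starT (l j : 'I_m.+1) : star T`_l T`_j = frame_vec (col j (Gamma l)).
  by rewrite GammaE; apply: eq_bigr => k _; rewrite mxE.
rewrite [p in LHS](coord_basis T_basis (memvf p)) linear_sumlz mulmx_suml linear_sum.
apply: eq_bigr => l _; rewrite linearZl_LR/= -scalemxAl linearZ/=; congr (_ *: _).
rewrite {1}/frame_vec linear_sumr/=.
under eq_bigr do rewrite linearZr_LR/= starT -linearZ/=.
rewrite -linear_sum; congr frame_vec; apply/colP => k.
by rewrite summxE !mxE; apply: eq_bigr => j _; rewrite !mxE mulrC.
Qed.

(** Applied to a basis column, the two products become [p * (q * x)] and [q * (p * x)], which agree
    by associativity and commutativity. *)
Lemma mul_mxC p q : GRing.comm (mul_mx p) (mul_mx q).
Proof.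
apply/matrixP => i j; rewrite -![_ * _]/(_ *m _).
suff /(congr1 (fun c : 'cV_m.+1 => c i 0)) : 
    mul_mx p *m mul_mx q *m delta_mx j 0
    = mul_mx q *m mul_mx p *m delta_mx j (0 : 'I_1).
  by rewrite -!colE !mxE.
apply: (can_inj frame_vecK); rewrite -!mulmxA -!star_frame_vec.
by rewrite starA [star p q]starC -starA.
Qed.

End Basis.
End Frame.

(** * The exponential along a commuting complex line *)

Section ExpmxLine.
Variables (R : realType) (d : nat).
Local Notation C := (R[i] : numFieldType).
Local Notation M := 'M[R[i]]_d.+1.

(** Stated for single entries so that the scalar product rule can be applied to matrix-vector
    products. *)
Lemma is_derive_expmx_line (X B : M) (s : C) j k : GRing.comm X B ->
  is_derive s (1 : C) (fun u : C => expmx (X + u *: B) j k : C)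
    ((expmx (X + s *: B) * B) j k).
Proof.
move=> cXB; set Y := X + s *: B.
have cYB : GRing.comm Y B.
  by apply/commr_sym/commrD; [exact/commr_sym | exact: commrZ].
pose E := expmx Y * B.
(* One constant serves both bounds of [is_diff_quadratic]: the first summand for the linear part,
   the second for the remainder, and 1 for positivity. *)
pose c := l1norm E +
  l1norm (1 : M) * l1norm B ^+ 2 * expR (4 * (1 + l1norm Y + l1norm B)) + 1.
have Y0 := l1norm_ge0 Y; have B0 := l1norm_ge0 B; have E0 := l1norm_ge0 E.
have q0 : 0 <= l1norm (1 : M) * l1norm B ^+ 2 * expR (4 * (1 + l1norm Y + l1norm B)).
  by rewrite !mulr_ge0 ?exprn_ge0 ?l1norm_ge0 ?expR_ge0.
have [df dE] : is_diff s (fun u : C => expmx (X + u *: B) j k : C)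
    (fun h : C => h * E j k).
  apply: (@is_diff_quadratic _ _ _ _ _ _ c%:C).
  - by move=> a x y; rewrite mulrDl scalerAl.
  - by rewrite ltcR /c; lra.
  - move=> h; rewrite !normr_normc normcM -rmorphM lecR mulrC ler_wpM2r ?normc_ge0//.
    by rewrite (le_trans (l1norm_entry _ _ _))// /c; lra.
  - move=> h; rewrite !normr_normc -rmorphXn/= -rmorphM -[1]/(1%:C) !lecR => h1.
    have -> : X + (h + s) *: B = Y + h *: B by rewrite scalerDl addrA addrAC.
    rewrite [X in normc X](_ : _ =
      (expmx (Y + h *: B) - expmx Y - expmx Y * (h *: B)) j k); last first.
      by rewrite -scalerAr !mxE.
    rewrite (le_trans (l1norm_entry _ _ _))//.
    have hB : l1norm (h *: B) <= l1norm B * normc h by rewrite l1normZ mulrC.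
    rewrite (le_trans (l1norm_expmxB_quadratic (commrZ h cYB) B0 (normc_ge0 h) h1 hB))//.
    by rewrite ler_wpM2r ?exprn_ge0 ?normc_ge0// /c; lra.
split; first exact: diff_derivable.
by rewrite deriveE// dE mul1r.
Qed.

End ExpmxLine.

(** * Flat sections of the Dubrovin connection *)

Section DubrovinFlat.
Variables (R : realType) (m : nat) (H : vectType R[i]) (T : m.+1.-tuple H).
Variables (star : {bilinear H -> H -> H}) (Gamma : 'I_m.+1 -> 'M[R[i]]_m.+1).
Hypothesis T_basis : basis_of fullv T.
Hypothesis starC : commutative star.
Hypothesis starA : associative star.
Hypothesis GammaE : forall i j : 'I_m.+1,
  star T`_i T`_j = \sum_(k < m.+1) Gamma i k j *: T`_k.
Local Notation C := (R[i] : numFieldType).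
Local Notation N := (@normed_vect C H).
Local Notation A := (mul_mx T Gamma).

Definition exp_field (c : 'cV[R[i]]_m.+1) (p : H) : H :=
  frame_vec T (expmx (- 'i *: A p) *m c).

Lemma is_diff_exp_field c (p : N) :
  is_diff p (exp_field c : N -> N)
    (fun v : N => frame_vec T (expmx (- 'i *: A p) *m (- 'i *: A v) *m c) : N).
Proof.
set X := - 'i *: A p; set E := expmx X.
have [a a0 ha] := frame_vec_bounded T.
have [b b0 hb] := linear_l1norm_bounded (- 'i \*: A).
(* [k1] controls the differential and [k2] the quadratic remainder; [a] comes from passing back to
   [H], and [b] from the map [v |-> - 'i *: A v]. *)
pose k1 := a * (l1norm E * b * l1norm c).
pose k2 := a * (l1norm (1 : 'M[R[i]]_m.+1) * b ^+ 2 *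
  expR (4 * (1 + l1norm X + b)) * l1norm c).
have X0 := l1norm_ge0 X; have c0 := l1norm_ge0 c; have E0 := l1norm_ge0 E.
have k10 : 0 <= k1 by rewrite !mulr_ge0.
have k20 : 0 <= k2 by rewrite !mulr_ge0 ?exprn_ge0 ?l1norm_ge0 ?expR_ge0.
apply: (@is_diff_quadratic _ _ _ _ _ _ (k1 + k2 + 1)%:C).
- move=> s u v.
  rewrite [LHS](_ : _ = frame_vec T (s *: (E *m (- 'i *: A u) *m c) +
      E *m (- 'i *: A v) *m c)); first exact: frame_vec_linear.
  congr frame_vec; rewrite linearP scalerDr scalerA [_ * s]mulrC -scalerA.
  by rewrite mulmxDr mulmxDl -[E *m (s *: _)]scalemxAr -scalemxAl.
- by rewrite ltcR; lra.
- move=> v; rewrite [X in _ * X]normr_Re -rmorphM; apply: le_trans (ha _) _; rewrite lecR.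
  have v0 := Re_normr_ge0 v.
  apply: (@le_trans _ _ (k1 * complex.Re `|v|)); last by rewrite ler_wpM2r//; lra.
  rewrite /k1 -mulrA ler_wpM2l//.
  rewrite (le_trans (l1normM _ _))// [leRHS]mulrAC ler_wpM2r// (le_trans (l1normM _ _))//.
  by rewrite -mulrA ler_wpM2l//; exact: hb.
- move=> v; rewrite [X in _ * X ^+ 2]normr_Re [X in X <= 1]normr_Re.
  rewrite -rmorphXn/= -rmorphM -[1]/(1%:C) lecR => v1.
  have v0 := Re_normr_ge0 v.
  set Y := - 'i *: A v.
  have -> : exp_field c (v + p) - exp_field c p - frame_vec T (E *m Y *m c)
    = frame_vec T ((expmx (X + Y) - E - E * Y) *m c).
    have XY : - 'i *: A ((v : H) + (p : H)) = X + Y.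
      by rewrite linearD scalerDr addrC.
    rewrite mulmxBl mulmxBl linearB/= linearB/= -XY; reflexivity.
  apply: le_trans (ha _) _; rewrite lecR.
  apply: (@le_trans _ _ (k2 * complex.Re `|v| ^+ 2)); last first.
    by rewrite ler_wpM2r ?exprn_ge0//; lra.
  rewrite /k2 -[leRHS]mulrA ler_wpM2l// [leRHS]mulrAC (le_trans (l1normM _ _))// ler_wpM2r//.
  have Yb : l1norm Y <= b * complex.Re `|v| by exact: hb.
  (* Associativity and commutativity of the product enter here. *)
  have cXY : GRing.comm X Y.
    apply: commrZ; apply/commr_sym/commrZ.
    exact: (mul_mxC T_basis starC starA GammaE).
  exact: l1norm_expmxB_quadratic cXY b0 v0 v1 Yb.
Qed.

(** The derivative contributes [- i E A(Y) c] and the product [i A(Y) E c]; they cancel because [E],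
    an exponential of a commuting matrix, commutes with [A(Y)]. *)
Lemma flat_exp_field c : flat_section star (exp_field c).
Proof.
have d p := is_diff_exp_field c p.
split=> [p|Y _ p]; first by have [] := d p.
rewrite /dubrovin; have [_ ->] := d p.
set E := expmx _.
transitivity (frame_vec T
    (E *m (- 'i *: A (Y p)) *m c + 'i *: (A (Y p) *m (E *m c)))).
  rewrite (star_frame_vec T_basis GammaE) linearD/=; congr (_ + _).
  by rewrite linearZ.
rewrite -[RHS](linear0 (frame_vec T)); congr frame_vec.
have cE : A (Y p) *m E = E *m A (Y p).
  apply/esym/expmx_comm/commr_sym/commrZ.
  exact: (mul_mxC T_basis starC starA GammaE).
by rewrite mulmxA cE -scalemxAr -scalemxAl scaleNr addNr.
Qed.

Lemma exp_field0 c : exp_field c 0 = frame_vec T c.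
Proof. by rewrite /exp_field linear0 scaler0 expmx0 mul1mx. Qed.

Lemma flat_section_dir X (p v : H) : flat_section star X ->
  is_diff (p : N) (X : N -> N) ('d (X : N -> N) (p : N)) /\
  'd (X : N -> N) (p : N) v = - 'i *: star v (X p).
Proof.
move=> [hX flX]; split; first by split=> //; exact: hX.
apply/eqP; rewrite scaleNr -addr_eq0; apply/eqP.
(* Flatness is tested on the constant field [v]. *)
apply: (flX (cst v)) => q; exact: differentiable_cst.
Qed.

(** Chain rule through [u |-> u *: p], then [X], then a coordinate. *)
Lemma is_derive_flat_coord X (p : H) (s : C) k : flat_section star X ->
  is_derive s (1 : C) (fun u : C => coord T k (X (u *: p)) : C)
    (coord T k (- 'i *: star p (X (s *: p)))).
Proof.
move=> flX; have [dX dXE] := flat_section_dir (s *: p) p flX.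
have [b b0 hb] := linear_l1norm_bounded (frame_coord T).
have d1 : is_diff s (fun u : C => u *: p : N) (fun u : C => u *: p : N).
  apply: (@is_diff_linear _ _ _ _ _ (`|p : N| + 1)).
  - by move=> a x y; rewrite scalerDl scalerA.
  - by rewrite ltr_wpDl.
  - by move=> v; rewrite normrZ mulrC ler_wpM2r// lerDl.
have d2 q : is_diff q (fun x : N => coord T k x : C) (fun x : N => coord T k x : C).
  apply: (@is_diff_linear _ _ _ _ _ (b + 1)%:C).
  - by move=> a x y; rewrite linearP.
  - by rewrite ltcR; lra.
  - move=> v; rewrite [X in _ * X]normr_Re -rmorphM normr_normc lecR.
    have := l1norm_entry (frame_coord T v) k 0; rewrite mxE => /le_trans; apply.
    by rewrite (le_trans (hb v))// ler_wpM2r ?Re_normr_ge0//; lra.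
have [df dE] := is_diff_comp (is_diff_comp d1 dX) (d2 _).
split; first exact: diff_derivable df.
by rewrite (deriveE _ df) dE /= scale1r dXE.
Qed.

Lemma flat_section_exp_field X : flat_section star X ->
  X = exp_field (frame_coord T (X 0)).
Proof.
move=> flX; apply/funext => p.
apply: (can_inj (frame_coordK T_basis)); rewrite /exp_field (frame_vecK T_basis).
set P := - 'i *: A p.
(* The [j]-th coordinate of [exp ((1 - u) P) X (u p)], the exponent being written in the shape of
   [is_derive_expmx_line]. At [u = 1] the exponential is the identity and leaves [X p]; at [u = 0]
   it acts on [X 0]. *)
pose g j (u : C) : C := \sum_k expmx (P + u *: - P) j k * coord T k (X (u *: p)).
have coordE (B : 'M[R[i]]_m.+1) x j :
    (B *m frame_coord T x) j 0 = \sum_k B j k * coord T k x.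
  by rewrite mxE; apply: eq_bigr => k _; rewrite mxE.
suff gg j : g j 1 = g j 0.
  rewrite -[LHS]mul1mx; apply/colP => j; rewrite !coordE; have := gg j.
  by rewrite /g !scale1r !scale0r addr0 subrr expmx0.
apply: is_derive_0_complex => s.
have -> : g j = \sum_(k < m.+1) ((fun u : C => expmx (P + u *: - P) j k : C)
    * (fun u : C => coord T k (X (u *: p)) : C)).
  by apply/funext => u; rewrite fct_sumE.
have cP : GRing.comm P (- P) by rewrite /GRing.comm mulrN mulNr.
have h k := is_deriveM (is_derive_expmx_line s j k cP) (is_derive_flat_coord p s k flX).
apply: (is_derive_eq (is_derive_sum h)).
set E := expmx _; set y := X _.
(* [E] is differentiated into [- E P], and [X (s p)] into [P X (s p)]. *)
transitivity ((E *m frame_coord T (- 'i *: star p y) + E *m - P *m frame_coord T y) j 0).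
  rewrite [RHS]mxE !coordE -big_split; apply: eq_bigr => k _.
  by congr (_ + _); exact: mulrC.
have -> : frame_coord T (- 'i *: star p y) = P *m frame_coord T y.
  rewrite -{1}(frame_coordK T_basis y) (star_frame_vec T_basis GammaE) linearZ/=.
  by rewrite (frame_vecK T_basis) scalemxAl.
by rewrite mulmxA mulmxN mulNmx subrr mxE.
Qed.

End DubrovinFlat.

Theorem proposition2p2 (R : realType) (m : nat) (H : vectType R[i])
    (star : {bilinear H -> H -> H})
    (starC : commutative star) (starA : associative star)
    (T : m.+1.-tuple H) (T_basis : basis_of fullv T)
    (Gamma : 'I_m.+1 -> 'M[R[i]]_m.+1)
    (GammaE : forall i j : 'I_m.+1,
      star T`_i T`_j = \sum_(k < m.+1) Gamma i k j *: T`_k) :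
  is_basis (flat_section star)
    (column_field T
      (fun p : H => expmx (- 'i *: \sum_(l < m.+1) coord T l p *: Gamma l))).
Proof.
set e := column_field T _.
(* A combination of columns is the matrix applied to the vector of coefficients. *)
have eE c : \sum_j c j *: e j = exp_field T Gamma (\col_j c j).
  apply/funext => p; rewrite /exp_field /frame_vec.
  transitivity (\sum_j \sum_(k < m.+1)
      c j *: (expmx (- 'i *: mul_mx T Gamma p) k j *: T`_k)).
    by rewrite fct_sumE; apply: eq_bigr => j _; exact: scaler_sumr.
  rewrite exchange_big; apply: eq_bigr => k _; rewrite mxE scaler_suml.
  by apply: eq_bigr => j _; rewrite mxE scalerA mulrC.
split=> [c|].
  (* Evaluation at the origin, where the exponential is the identity, recovers the coefficients. *)
  rewrite eE => /(congr1 (fun X : H -> H => frame_coord T (X 0))).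
  rewrite exp_field0 (frame_vecK T_basis) [frame_coord T _]linear0 => /colP c0 j.
  by have := c0 j; rewrite !mxE.
apply/seteqP; split=> [X /(flat_section_exp_field T_basis GammaE) ->|].
  (* The coefficients of a flat section are the coordinates of its value at the origin. *)
  exists (fun k => coord T k (X 0)) => //; rewrite eE.
  by congr exp_field; apply/colP => k; rewrite !mxE.
move=> _ [c _ <-]; rewrite eE.
exact: flat_exp_field T_basis starC starA GammaE _.
Qed.
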